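(* Let $N\ge1$, let $\omega\in L^1(-1,1)$ satisfy $\omega(x)>0$ for almost every $x\in(-1,1)$, and let $\mathcal S=\{s_1,\ldots,s_N\}$ be an $\omega$-admissible family of nondegenerate intervals in $[-1,1]$. Let $V$ be an algebraic complement of $\Pi_0$ in $\Pi_N$, i.e. $\Pi_N=\Pi_0\oplus V$. Then there exists a basis $\{\phi_1,\ldots,\phi_N\}$ of $V$ such that the matrix \[ D_N=\left[\int_{s_i}\phi_k'(x)\omega(x)\,dx\right]_{i,k=1}^N \] satisfies $D_N^\top D_N=I_N$.
   Context: $\Pi_n$ is the space of real univariate polynomials of degree at most $n$. A family of intervals $s_i=[a_i,b_i]\subset[-1,1]$, $a_i<b_i$, $i=1,\ldots,N$, is $\omega$-admissible if the linear map $\Pi_{N-1}\to\mathbb R^N$, $q\mapsto[\int_{s_i}q\,\omega\,dx]_{i=1}^N$, is an isomorphism. $I_N$ is the $N\times N$ identity matrix. *)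

(* Defs.v *)
From HB Require Import structures.
From mathcomp Require Import all_boot all_order all_algebra.
From mathcomp Require Import qpoly.
From mathcomp Require Import all_classical all_reals all_analysis.

Set Implicit Arguments.
Unset Strict Implicit.
Unset Printing Implicit Defensive.

Import Order.TTheory GRing.Theory Num.Theory.
Import numFieldNormedType.Exports.

Local Open Scope classical_set_scope.
Local Open Scope ring_scope.

(* Throughout, the space Pi_n of real polynomials of degree at most n is the
   R-vector space {poly_(n.+1) R} of polynomials of size at most n.+1; so
   Pi_(N-1) is {poly_N R} when 0 < N. *)

Definition wint (R : realType) (w : R -> R) (a b : R) (q : {poly R}) : R :=
  \int[lebesgue_measure]_(x in `[a, b]) (q.[x] * w x).

Definition wmoments (R : realType) (w : R -> R) (N : nat) (a b : 'I_N -> R)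
    (q : {poly_N R}) : 'rV[R]_N :=
  \row_i wint w (a i) (b i) q.

(* When w is integrable on ]-1, 1[ and the intervals lie in [-1, 1], all the
   integrals converge and wmoments is linear, so that it is an isomorphism of
   vector spaces iff it is bijective. *)
Definition admissible (R : realType) (w : R -> R) (N : nat)
    (a b : 'I_N -> R) : Prop :=
  bijective (wmoments w a b).

Definition constants (R : realType) (n : nat) : {vspace {poly_(n.+1) R}} :=
  <[npolyp n.+1 1]>%VS.

Definition algebraic_complement (R : fieldType) (E : vectType R)
    (U V : {vspace E}) : Prop :=
  (U + V)%VS = fullv /\ directv (U + V).

Definition diff_matrix (R : realType) (w : R -> R) (N : nat)
    (a b : 'I_N -> R) (phi : N.-tuple {poly_(N.+1) R}) : 'M[R]_N :=
  \matrix_(i, k) wint w (a i) (b i) (tnth phi k : {poly R})^`().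

(* Main.v *)
(** Admissibility provides q_1, ..., q_N in Pi_(N-1) whose moment vectors are the
    standard basis vectors. Antidifferentiate each q_k and subtract a constant so
    as to land in V: the resulting phi_k satisfy phi_k' = q_k, so D_N is not just
    orthogonal but equal to the identity. Linearity of the moments then makes the
    phi_k independent, and they form a basis because dim V = N. *)

Require Import Defs.
From HB Require Import structures.
From mathcomp Require Import all_boot all_order all_algebra.
From mathcomp Require Import qpoly.
From mathcomp Require Import all_classical all_reals all_analysis.
From mathcomp Require Import measurable_realfun.

Set Implicit Arguments.
Unset Strict Implicit.
Unset Printing Implicit Defensive.

Import Order.TTheory GRing.Theory Num.Theory.
Import numFieldNormedType.Exports.

Local Open Scope classical_set_scope.
Local Open Scope ring_scope.

(** The two endpoints form a null set. This matters because the weight is integrable on the open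
    interval, while the $s_i$ may touch $-1$ or $1$. *)
Lemma integrable_itv_oo_cc (R : realType) (x y : R) (f : R -> \bar R) :
  lebesgue_measure.-integrable `]x, y[ f ->
  lebesgue_measure.-integrable `[x, y] f.
Proof.
move=> /integrableP[mf f_fin].
have mf' := emeasurable_fun_itv_cc mf.
apply/integrableP; split => //; rewrite integral_itv_bndoo //.
by apply: measurableT_comp.
Qed.

(** A polynomial is bounded on a compact segment, and a bounded measurable factor preserves
    integrability. *)
Lemma integrable_hornerM (R : realType) (w : R -> R) (a b : R) (p : {poly R}) :
  lebesgue_measure.-integrable `[a, b] (EFin \o w) ->
  lebesgue_measure.-integrable `[a, b] (EFin \o (fun x => p.[x] * w x)).
Proof.
move=> iw; have cp : continuous (horner p) by exact: continuous_horner.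
rewrite (_ : EFin \o _ = ((EFin \o horner p) \* (EFin \o w))%E) //.
apply: integrableMr => //.
  by apply: measurable_funTS; exact: continuous_measurable_fun.
have /compact_bounded[M [Mreal Mp]] : compact (horner p @` `[a, b]).
  apply: continuous_compact; last exact: segment_compact.
  exact: continuous_subspaceT.
by exists M; split => // r Mr x abx; apply: Mp => //; exists x.
Qed.

Lemma wint0 (R : realType) (w : R -> R) (a b : R) : wint w a b 0 = 0.
Proof.
rewrite /wint; under eq_Rintegral do rewrite horner0 mul0r.
by rewrite /Rintegral integral0.
Qed.

Lemma wint_linear (R : realType) (w : R -> R) (a b : R) :
  lebesgue_measure.-integrable `[a, b] (EFin \o w) ->
  linear (wint w a b : {poly R} -> R^o).
Proof.
move=> iw c p q; rewrite /wint.
under eq_Rintegral do rewrite hornerD hornerZ mulrDl -mulrA.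
have ip := integrable_hornerM p iw; have iq := integrable_hornerM q iw.
rewrite RintegralD ?RintegralZl //.
exact: (integrableZl _ c ip).
Qed.

Lemma wint_sum (R : realType) (w : R -> R) (a b : R) (I : finType)
    (c : I -> R) (p : I -> {poly R}) :
  lebesgue_measure.-integrable `[a, b] (EFin \o w) ->
  wint w a b (\sum_i c i *: p i) = \sum_i c i * wint w a b (p i).
Proof.
move=> iw.
pose L : {linear {poly R} -> R^o} :=
  HB.pack (wint w a b : {poly R} -> R^o)
    (GRing.isLinear.Build _ _ _ _ _ (wint_linear iw)).
by rewrite -[wint w a b]/(L : _ -> _) linear_sum; under eq_bigr do rewrite linearZ.
Qed.

Lemma npoly_antiderivative (R : numFieldType) (n : nat) (q : {poly_n R}) :
  exists Q : {poly_(n.+1) R}, (Q : {poly R})^`() = q.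
Proof.
(* At [i = 0] the division by zero returns 0, so this is the antiderivative vanishing at the
   origin. *)
exists (mk_npoly n.+1 (fun i => q`_i.-1 / i%:R)).
apply/polyP => i; rewrite coef_deriv coef_poly ltnS /=.
case: ltnP => [_|n_le]; last by rewrite mul0rn big_coef_npoly.
by rewrite -[LHS]mulr_natr divfK // pnatr_eq0.
Qed.

Lemma deriv_constants (R : realType) (n : nat) (p : {poly_(n.+1) R}) :
  p \in constants R n -> (p : {poly R})^`() = 0.
Proof.
move=> /vlineP[c ->]; rewrite linearZ /= npolypK ?size_poly1 //.
by rewrite -polyC1 derivC scaler0.
Qed.

(** Split any antiderivative of [q] along $\Pi_0 + V$: dropping the constant component leaves the
    derivative unchanged. *)
Lemma complement_antiderivative (R : realType) (n : nat)
    (V : {vspace {poly_(n.+1) R}}) (q : {poly_n R}) :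
  algebraic_complement (constants R n) V ->
  exists2 v, v \in V & (v : {poly R})^`() = q.
Proof.
move=> [sumV _]; have [Q <-] := npoly_antiderivative q.
have : Q \in (constants R n + V)%VS by rewrite sumV memvf.
move=> /memv_addP[c /deriv_constants c0 [v Vv ->]].
by exists v => //; rewrite [in RHS]raddfD /= c0 add0r.
Qed.

Lemma dim_complement (R : realType) (n : nat) (V : {vspace {poly_(n.+1) R}}) :
  algebraic_complement (constants R n) V -> \dim V = n.
Proof.
move=> [sumV /directv_addP dxV]; apply/eqP; rewrite -eqSS.
have := dimv_disjoint_sum dxV; rewrite sumV dimvf dim_vline.
(* A line has dimension 1 only when its generator is nonzero, which the constant coefficient shows
   here. *)
suff -> : npolyp n.+1 1 != 0 :> {poly_(n.+1) R} by move=> /eqP; rewrite eq_sym.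
apply/negP => /eqP/(congr1 (fun p : {poly_(n.+1) R} => (p : {poly R})`_0)).
by rewrite coef_npolyp /= coef1 coef0 => /eqP; rewrite oner_eq0.
Qed.

Theorem theorem5 (R : realType) (N : nat) (hN : (0 < N)%N)
    (w : R -> R)
    (w_L1 : lebesgue_measure.-integrable `]-1, 1[ (EFin \o w))
    (w_pos : {ae lebesgue_measure, forall x : R, -1 < x < 1 -> 0 < w x})
    (a b : 'I_N -> R)
    (hab : forall i, -1 <= a i /\ a i < b i /\ b i <= 1)
    (hadm : admissible w a b)
    (V : {vspace {poly_(N.+1) R}})
    (hV : algebraic_complement (constants R N) V) :
  exists phi : N.-tuple {poly_(N.+1) R},
    basis_of V phi /\
    (diff_matrix w a b phi)^T *m diff_matrix w a b phi = 1%:M.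
Proof.
have iw i : lebesgue_measure.-integrable `[a i, b i] (EFin \o w).
  have [a_ge [_ b_le]] := hab i.
  apply: (integrableS _ _ _ (integrable_itv_oo_cc w_L1)) => //.
  by apply: subset_itv; rewrite bnd_simp.
have [g _ momentsK] := hadm.
(* [g (delta_mx 0 k)] is the polynomial $q_k$ whose moments are all 0 except the [k]-th, which is
   1. *)
have [phi phiV dphi] := fin_all_exists2
  (fun k : 'I_N => complement_antiderivative (g (delta_mx 0 k)) hV).
pose X := [tuple phi k | k < N].
have DX : diff_matrix w a b X = 1%:M.
  apply/matrixP => i k; rewrite !mxE tnth_mktuple dphi.
  by have /rowP/(_ i) := momentsK (delta_mx 0 k); rewrite !mxE eqxx.
exists X; split; last by rewrite DX trmx1 mulmx1.
(* As [X] has $N = \dim V$ entries, it remains to prove that it is free and spans a subspace of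
   [V]. *)
rewrite basisEfree size_tuple (dim_complement hV) leqnn andbT.
apply/andP; split; last first.
  by apply/span_subvP => _ /mapP[k _ ->]; exact: phiV.
apply/freeP => c c0 i.
have {}c0 : \sum_k c k *: phi k = 0.
  by rewrite -[RHS]c0; apply: eq_bigr => k _; rewrite -tnth_nth tnth_mktuple.
have dc0 : \sum_k c k *: (phi k : {poly R})^`() = 0.
  have := congr1 (fun p : {poly_(N.+1) R} => (p : {poly R})^`()) c0.
  rewrite (raddf_sum (val : {poly_(N.+1) R} -> {poly R})) /=.
  rewrite (raddf_sum (@deriv R)) deriv0 => dS0; rewrite -[RHS]dS0.
  by apply: eq_bigr => k _; rewrite /= derivZ.
have D_ij k : wint w (a i) (b i) (phi k : {poly R})^`() = (i == k)%:R.
  by have /matrixP/(_ i k) := DX; rewrite !mxE tnth_mktuple.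
(* The [i]-th moment of the differentiated relation isolates [c i], since the derivatives are dual
   to the moments. *)
transitivity (wint w (a i) (b i) (\sum_k c k *: (phi k : {poly R})^`())).
  rewrite wint_sum // (bigD1 i) //= D_ij eqxx mulr1 big1 ?addr0 // => k ki.
  by rewrite D_ij eq_sym (negbTE ki) mulr0.
by rewrite dc0 wint0.
Qed.
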